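(* Let $\mathbb{F}_2$ be the free group on generators $T_a,T_b$, let $X=\{a,b\}^{\mathbb{F}_2}$ with the product probability measure $m$ (each coordinate independently $a$ or $b$ with probability $\tfrac12$) on its Borel sets, and let $\mathbb{F}_2$ act by $(g(x))^h=x^{hg}$; write $x^e$ for the coordinate of $x$ at the identity. Use four colours $P^u,P^c,N^u,N^c$; a point is called ''coloured $P$'' if coloured $P^u$ or $P^c$, ''coloured $N$'' otherwise, ''crowded'' if coloured $P^c$ or $N^c$ and ''uncrowded'' otherwise. Given a colouring, place from each $x$ with $x^e=d\in\{a,b\}$ one arrow: to $T_d(x)$ if $x$ is coloured $P$, and to $T_d^{-1}(x)$ if $x$ is coloured $N$. The colouring rule (descendants $T_a^{\pm1}(x),T_b^{\pm1}(x)$) is: if $x^e=d$, $T_d(x)$ is uncrowded and $T_d^{-1}(x)$ is crowded, then $x$ is coloured $P$; if $x^e=d$, $T_d(x)$ is crowded and $T_d^{-1}(x)$ is uncrowded, then $x$ is coloured $N$; otherwise $x$ may be coloured $P$ or $N$; and $x$ is crowded if and only if at least two arrows (from among its four neighbours $T_a^{\pm1}(x),T_b^{\pm1}(x)$) point to $x$. Then this colouring rule is paradoxical.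
   Context: Setting: $(X,\mathcal F,m)$ is a probability space and the descendants $\phi_1,\dots,\phi_k:X\to X$ of a point are measurable, measure-preserving maps. A colouring rule prescribes, for each $x$ and each assignment of colours to $\phi_1(x),\dots,\phi_k(x)$, a nonempty set of allowed colours for $x$. A colouring $c$ satisfies the rule if the set of $x$ for which $c(x)$ is not allowed is contained in an $m$-null set. The rule is paradoxical if (i) some colouring (not necessarily measurable) satisfies it, and (ii) there is no finitely additive probability measure $\mu$, defined on an algebra of subsets of $X$ containing $\mathcal F$ and extending $m$, for which every descendant map remains measure preserving (for $\mu$-measurable $S$, $\phi_i^{-1}(S)$ is $\mu$-measurable with $\mu(\phi_i^{-1}(S))=\mu(S)$), together with a colouring satisfying the rule whose colour classes are all $\mu$-measurable. *)

(* Defs.v *)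
From HB Require Import structures.
From mathcomp Require Import all_boot all_order all_algebra.
From mathcomp Require Import all_classical all_reals all_analysis.

Set Implicit Arguments.
Unset Strict Implicit.
Unset Printing Implicit Defensive.

Import Order.TTheory GRing.Theory Num.Theory.
Local Open Scope classical_set_scope.

Section ColouringRules.
Context {d : measure_display} {X : measurableType d} {R : realType}.
Variables (m : probability X R) (I : finType) (C : Type).
Variables (phi : I -> X -> X) (allowed : X -> (I -> C) -> set C).

(* [allowed x k] is the set of colours permitted at [x] when each descendant
   [phi i x] is coloured [k i]. *)
Definition is_colouring_rule : Prop :=
  [/\ forall i, measurable_fun setT (phi i),
      forall i S, measurable S -> m (phi i @^-1` S) = m S &
      forall x k, allowed x k !=set0].

Definition satisfies (c : X -> C) : Prop :=
  m.-negligible [set x | ~ allowed x (fun i => c (phi i x)) (c x)].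

Definition set_algebra (A : set (set X)) : Prop :=
  [/\ A setT, setC_closed A & setU_closed A].

(* [mu] is only meaningful on the algebra [A]; elsewhere its values are junk. *)
Definition finitely_additive_probability (A : set (set X))
    (mu : set X -> \bar R) : Prop :=
  [/\ set_algebra A,
      forall S, A S -> (0 <= mu S)%E,
      mu setT = 1%E &
      forall S S', A S -> A S' -> S `&` S' = set0 ->
        mu (S `|` S') = (mu S + mu S')%E].

Definition extends (A : set (set X)) (mu : set X -> \bar R) : Prop :=
  forall S, measurable S -> A S /\ mu S = m S.

Definition preserved_by_descendants (A : set (set X))
    (mu : set X -> \bar R) : Prop :=
  forall i S, A S -> A (phi i @^-1` S) /\ mu (phi i @^-1` S) = mu S.

Definition paradoxical : Prop :=
  (exists c : X -> C, satisfies c) /\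
  ~ (exists (A : set (set X)) (mu : set X -> \bar R),
      [/\ finitely_additive_probability A mu,
          extends A mu,
          preserved_by_descendants A mu &
          exists c : X -> C,
            satisfies c /\ forall col, A (c @^-1` [set col])]).

End ColouringRules.

(* The free group on two generators, as reduced words.  The letter [(g, s)] is
   the generator named [g] ([true] for a, [false] for b) if [s = true], and its
   inverse if [s = false]. *)
Definition letter : Type := (bool * bool)%type.

Definition inv_letter (l : letter) : letter := (l.1, ~~ l.2).

Definition reduced (w : seq letter) : bool :=
  sorted (fun l l' => l' != inv_letter l) w.

Definition cons_letter (l : letter) (w : seq letter) : seq letter :=
  if w is l' :: w' then if l' == inv_letter l then w' else l :: w else [:: l].

Definition mul_word (u v : seq letter) : seq letter := foldr cons_letter v u.

Definition inv_word (w : seq letter) : seq letter := rev (map inv_letter w).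

Lemma inv_letterK : involutive inv_letter.
Proof. by case=> g s; rewrite /inv_letter /= negbK. Qed.

Lemma inv_wordK : involutive inv_word.
Proof. by move=> w; rewrite /inv_word map_rev revK (mapK inv_letterK). Qed.

Lemma reduced_behead l w : reduced (l :: w) -> reduced w.
Proof. exact: path_sorted. Qed.

Lemma cons_letter_id l w : reduced (l :: w) -> cons_letter l w = l :: w.
Proof. by rewrite /reduced; case: w => //= l' w /andP[/negbTE->]. Qed.

Lemma reduced_cons_letter l w : reduced w -> reduced (cons_letter l w).
Proof.
rewrite /reduced; case: w => //= l' w rw.
by case: eqP => [_|/eqP ll'] /=; [exact: path_sorted rw | rewrite ll'].
Qed.

Lemma cons_letterK l w :
  reduced w -> cons_letter l (cons_letter (inv_letter l) w) = w.
Proof.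
case: w => [|l' w] rw /=; first by rewrite eqxx.
rewrite inv_letterK; have [ll'|ll'] := eqVneq l' l; last by rewrite /= eqxx.
by rewrite ll' in rw *; rewrite cons_letter_id.
Qed.

Lemma reduced_mul u v : reduced v -> reduced (mul_word u v).
Proof. by move=> rv; elim: u => //= l u; exact: reduced_cons_letter. Qed.

Lemma reduced_inv w : reduced w -> reduced (inv_word w).
Proof.
rewrite /reduced /inv_word rev_sorted sorted_map.
by apply: sub_sorted => l l' /=; rewrite inv_letterK eq_sym.
Qed.

Lemma mul_cons_letter l u v : reduced v ->
  mul_word (cons_letter l u) v = cons_letter l (mul_word u v).
Proof.
case: u => //= l' u rv; case: eqP => [->|//].
by rewrite cons_letterK// reduced_mul.
Qed.

Lemma mul_wordA u v w : reduced w ->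
  mul_word u (mul_word v w) = mul_word (mul_word u v) w.
Proof. by move=> rw; elim: u => //= l u ->; rewrite mul_cons_letter. Qed.

Lemma mul_word0 u : reduced u -> mul_word u [::] = u.
Proof.
elim: u => //= l u IH ru; rewrite IH ?(reduced_behead ru)//.
exact: cons_letter_id.
Qed.

Lemma mul_inv_word u : mul_word (inv_word u) u = [::].
Proof.
elim: u => //= l u IH.
by rewrite /inv_word /= rev_cons /mul_word foldr_rcons /= inv_letterK eqxx.
Qed.

Record F2 := FreeWord { word_of : seq letter; _ : reduced word_of }.

HB.instance Definition _ := [isSub for word_of].
HB.instance Definition _ := [Countable of F2 by <:].

Lemma word_of_reduced (g : F2) : reduced (word_of g).
Proof. exact: (valP g). Qed.

Definition F2_one : F2 := @FreeWord [::] isT.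
Definition F2_mul (g h : F2) : F2 :=
  FreeWord (reduced_mul (word_of g) (word_of_reduced h)).
Definition F2_inv (g : F2) : F2 := FreeWord (reduced_inv (word_of_reduced g)).

Lemma F2_mulA : associative F2_mul.
Proof. by move=> g h k; apply: val_inj; exact/mul_wordA/word_of_reduced. Qed.

Lemma F2_mul1g : left_id F2_one F2_mul.
Proof. by move=> g; exact: val_inj. Qed.

Lemma F2_mulg1 : right_id F2_one F2_mul.
Proof. by move=> g; apply: val_inj; exact/mul_word0/word_of_reduced. Qed.

Lemma F2_mulVg : left_inverse F2_one F2_inv F2_mul.
Proof. by move=> g; apply: val_inj; exact: mul_inv_word. Qed.

Lemma F2_mulgV : right_inverse F2_one F2_inv F2_mul.
Proof.
move=> g; apply: val_inj => /=.
by rewrite -[X in mul_word X _]inv_wordK mul_inv_word.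
Qed.

HB.instance Definition _ :=
  isGroup.Build F2 F2_mulA F2_mul1g F2_mulg1 F2_mulVg F2_mulgV.

(* [gen true] is T_a and [gen false] is T_b. *)
Definition gen (g : bool) : F2 := @FreeWord [:: (g, true)] isT.

(* {a,b}^F2 with its Borel sets; [true] stands for a and [false] for b. *)
Definition shift_space : Type := g_sigma_algebraType (@open {ptws F2 -> bool}).
HB.instance Definition _ := Measurable.on shift_space.

Definition coordinate (x : shift_space) (h : F2) : bool := x h.

Definition F2_act (g : F2) (x : shift_space) : shift_space :=
  fun h => coordinate x (h * g)%g.

(* Cylinders are a pi-system generating the Borel sets, so this determines
   [m] uniquely. *)
Definition is_fair_product_measure {R : realType}
    (m : probability shift_space R) : Prop :=
  forall (s : seq F2) (y : F2 -> bool), uniq s ->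
    m [set x | forall h, h \in s -> coordinate x h = y h] =
    ((2^-1 : R) ^+ size s)%R%:E.

Inductive colour := Pu | Pc | Nu | Nc.

Definition coloured_P (c : colour) : bool :=
  match c with Pu | Pc => true | Nu | Nc => false end.

Definition crowded (c : colour) : bool :=
  match c with Pc | Nc => true | Pu | Nu => false end.

(* The descendant of index [(g, s)] is T_g(x) if [s = true] and T_g^-1(x) if
   [s = false]. *)
Definition descendant (i : bool * bool) (x : shift_space) : shift_space :=
  F2_act (if i.2 then gen i.1 else (gen i.1)^-1)%g x.

Definition arrow_target (x : shift_space) (c : colour) : shift_space :=
  descendant (coordinate x 1%g, coloured_P c) x.

(* Each point emits a single arrow, so two arrows into [x] are two distinct
   neighbouring points whose arrows end at [x]. *)
Definition two_arrows_to (x : shift_space) (k : bool * bool -> colour) : Prop :=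
  exists i j, [/\ descendant i x <> descendant j x,
    arrow_target (descendant i x) (k i) = x &
    arrow_target (descendant j x) (k j) = x].

Definition allowed_colour (x : shift_space) (k : bool * bool -> colour) :
    set colour :=
  [set c |
    [/\ ~~ crowded (k (coordinate x 1%g, true)) ->
          crowded (k (coordinate x 1%g, false)) -> coloured_P c,
        crowded (k (coordinate x 1%g, true)) ->
          ~~ crowded (k (coordinate x 1%g, false)) -> ~~ coloured_P c &
        crowded c <-> two_arrows_to x k]].

(* Main.v *)
Require Import Defs.
From mathcomp Require Import all_boot all_order all_algebra.
From mathcomp Require Import all_classical all_reals all_analysis.
From mathcomp Require Import ring lra.

(* Almost every point is free, so its orbit is a copy of the 4-regular tree.
   Choosing a root in each orbit and letting all arrows point away from it, a
   point receives at most one arrow, from its neighbour towards the root: all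
   points are uncrowded and the rule holds.

   Conversely, regard each point [x] as an edge between its possible targets
   [T_d x] and [T_d^-1 x], oriented by the arrow of [x].  By the rule an edge
   pointing to a crowded point starts at a crowded point.  For an invariant
   finitely additive [mu], counting by preservation of [mu], there are thus at
   least [2 mu(C)] edges inside the crowded set [C]; as a point lies on at most
   four edges, almost all crowded points have all four edges, with crowded other
   ends.  Following one direction forever, a crowded point sees a fixed infinite
   pattern of labels, so [mu(C) = 0].  Then almost every point receives at most
   one arrow, and on average exactly one, although the points that lie on no
   edge at all form a set of positive measure. *)

Set Implicit Arguments.
Unset Strict Implicit.
Unset Printing Implicit Defensive.

Import Order.TTheory GRing.Theory Num.Theory.
Local Open Scope classical_set_scope.

(** * Cylinders and the Borel sets of the shift space *)

Definition cylinder (l : seq (F2 * bool)) : set shift_space :=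
  [set x | forall p, p \in l -> coordinate x p.1 = p.2].

Lemma cylinder_cat l l' : cylinder (l ++ l') = cylinder l `&` cylinder l'.
Proof.
apply/seteqP; split=> x /=.
  move=> xll'; split=> p pl; apply: xll'; by rewrite mem_cat pl ?orbT.
by move=> [xl xl'] p; rewrite mem_cat => /orP[/xl|/xl'].
Qed.

Lemma cylinder_point l x : cylinder l x ->
  cylinder l =
    [set y | forall h, h \in undup (unzip1 l) -> coordinate y h = x h].
Proof.
move=> xl; apply/seteqP; split=> y yl /=.
  by move=> h; rewrite mem_undup => /mapP[p pl ->]; rewrite yl// -xl.
by move=> p pl; rewrite yl ?mem_undup ?map_f//; exact: xl.
Qed.

(** Sets fixing finitely many coordinates of [x] generate a filter [F], and convergence of [F] in
    the pointwise topology can be tested one coordinate at a time. *)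
Lemma nbhs_cylinder (x : {ptws F2 -> bool}) (U : set {ptws F2 -> bool}) :
  nbhs x U -> exists s : seq F2,
    [set y : {ptws F2 -> bool} | {in s, x =1 y}] `<=` U.
Proof.
pose F : set_system {ptws F2 -> bool} := [set U | exists s : seq F2,
    [set y : {ptws F2 -> bool} | {in s, x =1 y}] `<=` U].
suff: F --> x by move=> /(_ U) h /h.
have FF : Filter F.
  split; first by exists [::].
    move=> P Q [s sP] [t tQ]; exists (s ++ t) => y xy; split.
      by apply: sP => h hs; apply: xy; rewrite mem_cat hs.
    by apply: tQ => h hs; apply: xy; rewrite mem_cat hs orbT.
  by move=> P Q PQ [s sP]; exists s; exact: subset_trans PQ.
apply/cvg_sup => h V [W [[Z oZ <-] Zx ZV]].
exists [:: h] => y xy; apply: ZV => /=.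
by rewrite -(xy h) ?inE.
Qed.

Lemma open_cylinder h b : open [set x : {ptws F2 -> bool} | x h = b].
Proof.
rewrite (_ : [set _ | _] = proj h @^-1` [set b])//.
apply: open_comp => [y _|]; first exact: proj_continuous.
exact: discrete_open.
Qed.

Lemma measurable_coordinate h b :
  measurable [set x : shift_space | coordinate x h = b].
Proof. by apply: sub_sigma_algebra; exact: open_cylinder. Qed.

Lemma measurable_cylinder l : measurable (cylinder l).
Proof.
elim: l => [|[h b] l IH].
  by rewrite (_ : cylinder _ = setT)//; apply/seteqP; split.
rewrite -cat1s cylinder_cat; apply: measurableI => //.
rewrite (_ : cylinder _ = [set x | coordinate x h = b]).
  exact: measurable_coordinate.
apply/seteqP; split=> x /=; first by move=> /(_ (h, b)); apply; rewrite inE.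
by move=> xh p; rewrite inE => /eqP ->.
Qed.

Lemma open_bigcup_cylinder (O : set {ptws F2 -> bool}) : open O ->
  O = \bigcup_(l in [set l | cylinder l `<=` O]) cylinder l.
Proof.
rewrite openE => oO; apply/seteqP; split; last by move=> x [l lO]; exact: lO.
move=> x /oO /nbhs_cylinder[s sO].
exists [seq (h, (x : F2 -> bool) h) | h <- s].
  move=> y ys; apply: sO => h hs.
  by apply/esym/(ys (h, (x : F2 -> bool) h))/mapP; exists h.
by move=> _ /mapP[h hs ->].
Qed.

(** Lists of constraints form a countable type, so each open set is a countable union of
    cylinders. *)
Lemma measurable_shift_space :
  @measurable _ shift_space = <<s [set cylinder l | l in setT] >>.
Proof.
apply/seteqP; split; last first.
  apply: smallest_sub; first exact: sigma_algebra_measurable.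
  by move=> _ [l _ <-]; exact: measurable_cylinder.
apply: smallest_sub; first exact: smallest_sigma_algebra.
move=> O /open_bigcup_cylinder ->.
rewrite bigcup_mkcond.
apply: (@countable_bigcupT_measurable _
  (g_sigma_algebraType [set cylinder l | l in setT])) => // l.
case: ifP => _; last exact: measurable0.
by apply: sub_sigma_algebra; exists l.
Qed.

Lemma F2_act_cylinder g l :
  F2_act g @^-1` cylinder l = cylinder [seq (p.1 * g, p.2)%g | p <- l].
Proof.
apply/seteqP; split=> x /= xl.
  by move=> _ /mapP[p pl ->] /=; exact: xl.
by move=> p pl; apply: (xl (p.1 * g, p.2)%g); apply/mapP; exists p.
Qed.

Lemma measurable_F2_act g : measurable_fun setT (F2_act g).
Proof.
apply: (measurability _ measurable_shift_space) => _ [_ [l _ <-] <-].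
by rewrite setTI F2_act_cylinder; exact: measurable_cylinder.
Qed.

Lemma F2_actM g h x : F2_act g (F2_act h x) = F2_act (g * h)%g x.
Proof. by apply/funext => k; rewrite /F2_act /coordinate mulgA. Qed.

Lemma F2_act1 x : F2_act 1%g x = x.
Proof. by apply/funext => k; rewrite /F2_act /coordinate mulg1. Qed.

(** * Invariance of the fair product measure *)

Section FairProductMeasure.
Context {R : realType} (m : probability shift_space R).
Hypothesis hm : is_fair_product_measure m.

Lemma cylinder_fair (l : seq (F2 * bool)) : uniq (unzip1 l) ->
  m (cylinder l) = ((2^-1 : R) ^+ size l)%R%:E.
Proof.
(* As positions in [l] do not repeat, [(h, true) \in l] is the value that [l] prescribes at [h]. *)
move=> ul; rewrite -(size_map fst) -(hm (fun h => (h, true) \in l) ul).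
congr (m _); apply/seteqP; split=> x xl /=.
  move=> h /mapP[[k b] kl /= ->]; rewrite (xl _ kl)/=.
  case: b kl => [-> //|kl]; apply/esym/negP => kl'.
  by have := xl _ kl; rewrite (xl _ kl').
move=> [h b] hl /=; rewrite xl; last by apply/mapP; exists (h, b).
case: b hl => [-> //|hl]; apply/negP => hl'.
elim: l ul hl hl' {xl} => //= -[k b] l IH /andP[kl ul].
have khl b' : (h, b') \in l -> h != k.
  by move=> hl; apply: contraNneq kl => <-; apply/mapP; exists (h, b').
rewrite !inE !xpair_eqE => /orP[/andP[/eqP hk /eqP <-]|hl].
  by rewrite andbF/= => /khl; rewrite hk eqxx.
by rewrite (negbTE (khl _ hl))/= => hl'; exact: (IH ul hl hl').
Qed.

(** [m] and its pushforward agree on cylinders, a pi-system generating the Borel sets. *)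
Lemma F2_act_preserving g S : measurable S -> m (F2_act g @^-1` S) = m S.
Proof.
pose pm := measure_function_pushforward__canonical__measure_function_Measure
  m (measurable_F2_act g).
move=> mS; change (pm S = m S).
apply: (measure_unique [set cylinder l | l in setT] (fun=> setT)
    measurable_shift_space) => //.
- move=> _ _ [l _ <-] [l' _ <-]; exists (l ++ l') => //.
  exact: cylinder_cat.
- by move=> _; exists [::] => //; apply/seteqP; split.
- by rewrite bigcup_const.
- move=> _ [l _ <-]; rewrite /pm /= /pushforward.
  have [->|/set0P[x xl]] := eqVneq (cylinder l) set0.
    by rewrite preimage_set0.
  rewrite (cylinder_point xl) hm ?undup_uniq//.
  rewrite -(size_map (fun h => h * g)%g) -(hm (fun h => x (h * g^-1)%g)).
    congr (m _); apply/seteqP; split=> z zl.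
      by move=> _ /mapP[h hl ->]; rewrite mulgK; exact: zl.
    move=> h hl; rewrite /F2_act /coordinate /=.
    by rewrite [LHS](zl _ (map_f _ hl)) mulgK.
  by rewrite map_inj_uniq ?undup_uniq//; exact: mulIg.
- by move=> _; rewrite /pm /= /pushforward preimage_setT probability_setT ltry.
Qed.

End FairProductMeasure.

(** * Letters as elements of the free group *)

Definition letter_elt (l : letter) : F2 :=
  (if l.2 then gen l.1 else (gen l.1)^-1)%g.

Lemma word_letter_mul l g :
  word_of (letter_elt l * g)%g = cons_letter l (word_of g).
Proof. by case: l => a []. Qed.

Lemma word_letter l : word_of (letter_elt l) = [:: l].
Proof. by case: l => a []. Qed.

Lemma letter_elt_inj : injective letter_elt.
Proof. by move=> i j /(congr1 word_of); rewrite !word_letter => -[]. Qed.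

Lemma letter_elt_inv l : letter_elt (inv_letter l) = (letter_elt l)^-1%g.
Proof. by case: l => a [] /=; rewrite ?invgK. Qed.

Lemma word_expg_gen a n : word_of (gen a ^+ n)%g = nseq n (a, true).
Proof.
elim: n => [//|n IH]; rewrite expgS.
rewrite (word_letter_mul (a, true)) IH; case: n {IH} => //= n.
by rewrite /inv_letter/= xpair_eqE andbF.
Qed.

Lemma F2_fresh (s : seq F2) : exists g, g \notin s.
Proof.
exists (gen true ^+ (\max_(h <- s) size (word_of h)).+1)%g.
apply/negP => gs.
have := @leq_bigmax_seq _ s xpredT (fun h => size (word_of h)) _ gs isT.
by rewrite word_expg_gen size_nseq ltnn.
Qed.

Lemma pow2_le0 (R : realType) (r : R) :
  (forall n, r <= 2^-1 ^+ n)%R -> (r <= 0)%R.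
Proof.
move=> rn; rewrite leNgt; apply/negP => r0.
have := @upper_nthrootP _ (r^-1) _ (leqnn _); set n := Num.bound _ => rn2.
have := rn n; rewrite leNgt => /negP; apply.
by rewrite exprVn -ltf_pV2 ?posrE ?invr_gt0 ?exprn_gt0// invrK.
Qed.

(** * Almost every point is free *)

Definition free_point (x : shift_space) := forall g, F2_act g x = x -> g = 1%g.

Lemma free_act_inj x g h : free_point x -> F2_act g x = F2_act h x -> g = h.
Proof.
move=> fx gh; have : (h^-1 * g)%g = 1%g.
  by apply: fx; rewrite -F2_actM gh F2_actM mulVg F2_act1.
by move=> /(congr1 (fun k => h * k)%g); rewrite mulgA mulgV mul1g mulg1.
Qed.

Section FreePoints.
Context {R : realType} (m : probability shift_space R).
Hypothesis hm : is_fair_product_measure m.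

(** Not being fixed means that the coordinates at some [h] and [h * g] differ, which gives a
    countable union of cylinders. *)
Lemma measurable_fixpoints g : measurable [set x | F2_act g x = x].
Proof.
rewrite (_ : [set _ | _] = ~` \bigcup_(h : F2) \bigcup_(b : bool)
    cylinder [:: (h, b); (h * g, ~~ b)%g]); last first.
  apply/seteqP; split=> x /=.
    move=> gx [h _ [b _ hb]].
    have xh : coordinate x h = b by apply: (hb (h, b)); rewrite inE eqxx.
    have : coordinate x (h * g)%g = ~~ b.
      by apply: (hb (h * g, ~~ b)%g); rewrite !inE eqxx orbT.
    rewrite -[coordinate x (h * g)%g]/(F2_act g x h) gx [x h]xh.
    by case: b {hb xh}.
  move=> nx; apply/funext => h; apply/eqP/negPn/negP => /eqP gh; apply: nx.
  exists h => //; exists (coordinate x h) => // p.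
  rewrite !inE => /orP[]/eqP-> //=.
  move: gh; rewrite /F2_act.
  by case: coordinate; rewrite /coordinate; case: (x h).
apply: measurableC; apply: countable_bigcupT_measurable => // h.
by apply: countable_bigcupT_measurable => // b; exact: measurable_cylinder.
Qed.

(* Prescribing a fixed point of [g] at two new positions [h] and [h * g] costs
   a factor 4, but there are only two ways of doing so. *)
Lemma cylinder_fixpoints_le g n (l : seq (F2 * bool)) :
  g != 1%g -> uniq (unzip1 l) ->
  (m (cylinder l `&` [set x | F2_act g x = x]) <=
    ((2^-1 : R) ^+ (size l + n))%R%:E)%E.
Proof.
move=> g1; have mlg k : measurable (cylinder k `&` [set x | F2_act g x = x]).
  apply: measurableI; first exact: measurable_cylinder.
  exact: measurable_fixpoints.
elim: n l => [|n IH] l ul.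
  rewrite addn0 -(cylinder_fair hm ul); apply: le_measure; rewrite ?inE//.
  exact: measurable_cylinder.
(* Both new positions [h] and [h * g] must avoid [l], hence the translate by [g^-1]. *)
have [h] := F2_fresh (unzip1 l ++ [seq k * g^-1 | k <- unzip1 l])%g.
rewrite mem_cat negb_or => /andP[hl hgl].
have hgl' : (h * g)%g \notin unzip1 l.
  apply: contra hgl => hgl; apply/mapP.
  by exists (h * g)%g => //; rewrite mulgK.
have hhg : h != (h * g)%g.
  apply: contraNneq g1 => /esym hg; apply/eqP/(mulgI h); by rewrite hg mulg1.
pose lb b := [:: (h, b), (h * g, b)%g & l].
have ulb b : uniq (unzip1 (lb b)) by rewrite /= inE negb_or hhg hl hgl'.
apply: (@le_trans _ _ (m ((cylinder (lb true) `&` [set x | F2_act g x = x]) `|`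
    (cylinder (lb false) `&` [set x | F2_act g x = x])))).
  apply: le_measure; rewrite ?inE//.
    exact: measurableU.
  move=> x [xl gx]; rewrite -setIUl; split=> //=.
  have xb b : coordinate x h = b -> cylinder (lb b) x.
    move=> xh p; rewrite !inE => /or3P[/eqP->//|/eqP->/=|/xl//].
    by rewrite -xh -{2}gx.
  by have := xb (coordinate x h) erefl; case: coordinate => ?; [left|right].
apply: le_trans (measureU2 _ _ _) _ => //.
apply: le_trans (leeD (IH _ (ulb true)) (IH _ (ulb false))) _.
rewrite -EFinD lee_fin /= !(addnS, addSn) !exprS.
set t := (_ ^+ _)%R; rewrite le_eqVlt; apply/orP; left; apply/eqP.
by field.
Qed.

Lemma fixpoints_null g : g != 1%g -> m [set x | F2_act g x = x] = 0%E.
Proof.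
move=> g1; apply/eqP; rewrite eq_le measure_ge0 andbT.
have fm : m [set x | F2_act g x = x] \is a fin_num.
  by apply: fin_num_measure; exact: measurable_fixpoints.
rewrite -(fineK fm) lee_fin; apply: pow2_le0 => n.
rewrite -lee_fin fineK//.
have := @cylinder_fixpoints_le g n [::] g1 isT.
by rewrite (_ : cylinder [::] = setT) ?setTI//; apply/seteqP; split.
Qed.

Lemma negligible_not_free : m.-negligible [set x | ~ free_point x].
Proof.
pose F (n : nat) : set shift_space :=
  if (unpickle n : option F2) is Some g then
    if g == 1%g then set0 else [set x | F2_act g x = x]
  else set0.
have : m.-negligible (\bigcup_n F n).
  apply: negligible_bigcup => n; rewrite /F.
  case: unpickle => [g|]; last exact: negligible_set0.
  case: eqVneq => [_|g1]; first exact: negligible_set0.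
  apply/negligibleP; [exact: measurable_fixpoints|exact: fixpoints_null].
apply: negligibleS => x /= /existsNP[g /not_implyP[gx /eqP g1]].
by exists (pickle g) => //; rewrite /F pickleK (negbTE g1).
Qed.

End FreePoints.

(** * Roots of orbits and the outward colouring *)

Definition root (x : shift_space) : shift_space :=
  xget point [set y | exists g, y = F2_act g x].

(** The set chosen from is the orbit itself, so the choice is constant along it. *)
Lemma root_act g x : root (F2_act g x) = root x.
Proof.
congr xget; apply/seteqP; split=> y /= [h ->].
  by exists (h * g)%g; rewrite F2_actM.
by exists (h * g^-1)%g; rewrite F2_actM -mulgA mulVg mulg1.
Qed.

Lemma root_orbit x : exists g, F2_act g (root x) = x.
Proof.
have : [set y | exists g, y = F2_act g x] (root x).
  apply: (@xgetPex _ _ [set y | exists g, y = F2_act g x]).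
  by exists x, 1%g; rewrite F2_act1.
by move=> /= [g ->]; exists g^-1%g; rewrite F2_actM mulVg F2_act1.
Qed.

(** The default [1%g] never occurs, by [root_orbit]; at a point that is not free, the value is one
    choice among several. *)
Definition position (x : shift_space) : F2 :=
  xget 1%g [set g | F2_act g (root x) = x].

Lemma positionP x : F2_act (position x) (root x) = x.
Proof. exact/(@xgetPex _ _ [set g | F2_act g (root x) = x])/root_orbit. Qed.

Lemma position_act g x :
  free_point x -> position (F2_act g x) = (g * position x)%g.
Proof.
move=> fx; have fxE h : F2_act (h * position x)%g (root x) = F2_act h x.
  by rewrite -F2_actM positionP.
have := positionP (F2_act g x); rewrite root_act.
rewrite -{1}[position _](mulgVK (position x)) fxE => /(free_act_inj fx) e.
by rewrite -[LHS](mulgVK (position x)) e.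
Qed.

(* Every arrow points away from the root of the orbit, so a point can only
   receive an arrow from the neighbour leading to the root. *)
Definition outward_colour (x : shift_space) : colour :=
  if ohead (word_of (position x)) == Some (coordinate x 1%g, false)
  then Nu else Pu.

Lemma descendantE i : descendant i = F2_act (letter_elt i).
Proof. by []. Qed.

(** The colour is [Nu] exactly when prepending the positive letter would cancel, so following the
    arrow always lengthens the reduced word. *)
Lemma arrow_target_outward x : free_point x ->
  exists i, word_of (position (arrow_target x (outward_colour x))) =
    i :: word_of (position x).
Proof.
move=> fx; rewrite /arrow_target descendantE position_act//.
rewrite word_letter_mul.
exists (coordinate x 1%g, coloured_P (outward_colour x)).
rewrite /outward_colour.
case: (word_of (position x)) => [|l w] //=.
case: l => a s; rewrite (inj_eq Some_inj) /inv_letter /=.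
have [[-> ->]|] := eqVneq (a, s) (coordinate x 1%g, false).
  by rewrite xpair_eqE andbF.
by rewrite xpair_eqE /= => /negbTE ->.
Qed.

Lemma free_descendant i x : free_point x -> free_point (descendant i x).
Proof.
move=> fx g gix; rewrite -(mulgK (letter_elt i) g).
have -> : (g * letter_elt i)%g = letter_elt i.
  by apply: (free_act_inj fx); rewrite -F2_actM.
by rewrite mulgV.
Qed.

(** Both senders have the root of [x], and their position is that of [x] without its first letter;
    so they coincide. *)
Lemma outward_colour_uncrowded x : free_point x ->
  ~ two_arrows_to x (fun i => outward_colour (descendant i x)).
Proof.
move=> fx [i [j [ij ix jx]]]; apply: ij.
have [k] := arrow_target_outward (free_descendant (i := i) fx).
have [l] := arrow_target_outward (free_descendant (i := j) fx).
rewrite ix jx => -> [_ /val_inj pij].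
by rewrite -[LHS]positionP -[RHS]positionP pij !descendantE !root_act.
Qed.

Lemma outward_colour_satisfies {R : realType} (m : probability shift_space R) :
  is_fair_product_measure m ->
  satisfies m descendant allowed_colour outward_colour.
Proof.
move=> hm; apply: negligibleS (negligible_not_free hm) => x /= nx fx; apply: nx.
have uc y : crowded (outward_colour y) = false.
  by rewrite /outward_colour; case: ifP.
by split; rewrite !uc// ; split=> // /(outward_colour_uncrowded fx).
Qed.

Lemma colouring_rule {R : realType} (m : probability shift_space R) :
  is_fair_product_measure m -> is_colouring_rule m descendant allowed_colour.
Proof.
move=> hm; split=> [i|i S mS|x k].
- exact: measurable_F2_act.
- exact: F2_act_preserving.
(* Crowding and sign are constrained independently: [two_arrows_to] decides the former, and N is
   forced only if [p] is crowded and [q] is not. *)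
set p := k (coordinate x 1%g, true); set q := k (coordinate x 1%g, false).
have [xk|xk] := pselect (two_arrows_to x k).
- exists (if crowded p && ~~ crowded q then Nc else Pc); split.
  + by rewrite -/p -/q => /negbTE ->.
  + by rewrite -/p -/q => -> ->.
  + by case: ifP; split.
- exists (if crowded p && ~~ crowded q then Nu else Pu); split.
  + by rewrite -/p -/q => /negbTE ->.
  + by rewrite -/p -/q => -> ->.
  + by case: ifP; split.
Qed.

(** * Finitely additive probabilities on an algebra of sets *)

Section Content.
Context {d : measure_display} {X : measurableType d} {R : realType}.
Variables (A : set (set X)) (mu : set X -> \bar R).
Hypothesis Amu : finitely_additive_probability A mu.
Local Open Scope ring_scope.

Let nu (S : set X) : R := fine (mu S).

Let AC S : A S -> A (~` S).
Proof. by case: Amu => -[_ h _] _ _ _; exact: h. Qed.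

Let AU S S' : A S -> A S' -> A (S `|` S').
Proof. by case: Amu => -[_ _ h] _ _ _; exact: h. Qed.

Lemma set_algebraI S S' : A S -> A S' -> A (S `&` S').
Proof.
by move=> aS aS'; rewrite -[S `&` S']setCK setCI; apply/AC/AU; exact: AC.
Qed.

Let AT : A setT. Proof. by case: Amu => -[]. Qed.

Let mu_fin S : A S -> mu S \is a fin_num.
Proof.
move=> aS; have [_ ge0 mu1 muD] := Amu.
have := muD _ _ aS (AC aS) (setICr S); rewrite setUCr mu1 => h.
rewrite ge0_fin_numE ?ge0//; apply: (@le_lt_trans _ _ 1%E); last exact: ltry.
by rewrite h leeDl// ge0//; exact: AC.
Qed.

Lemma content_ge0 S : A S -> 0 <= nu S.
Proof. by move=> aS; apply: fine_ge0; case: Amu => _ h _ _; exact: h. Qed.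

Lemma content_setT : nu setT = 1.
Proof. by rewrite /nu; case: Amu => _ _ ->. Qed.

Lemma content_split S F : A S -> A F -> nu S = nu (S `&` F) + nu (S `&` ~` F).
Proof.
move=> aS aF; have aSF := set_algebraI aS aF.
have aSCF := set_algebraI aS (AC aF).
rewrite -[LHS]/(fine (mu S)) -{1}(setIT S) -(setUCr F) setIUr.
case: Amu => _ _ _ -> //; first by rewrite fineD// mu_fin.
by rewrite setIACA setICr setI0.
Qed.

Lemma content_set0 : nu set0 = 0.
Proof.
have a0 : A set0 by rewrite -setCT; exact: AC.
by have := content_split a0 a0; rewrite !set0I; lra.
Qed.

Lemma content_le S S' : A S -> A S' -> S `<=` S' -> nu S <= nu S'.
Proof.
move=> aS aS' SS'; rewrite (content_split aS' aS) setIidr// lerDl.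
by apply: content_ge0; apply: set_algebraI => //; exact: AC.
Qed.

Lemma content_null_sub S S' : A S -> A S' -> S `<=` S' -> nu S' = 0 -> nu S = 0.
Proof.
move=> aS aS' SS' S'0; apply/eqP; rewrite eq_le content_ge0// andbT -S'0.
exact: content_le.
Qed.

Lemma content_setU_null S S' : A S -> A S' -> nu S = 0 -> nu S' = 0 ->
  nu (S `|` S') = 0.
Proof.
move=> aS aS' S0 S'0; have aSS' := AU aS aS'.
rewrite (content_split aSS' aS) setIUl setIid setUidl; last by move=> x [].
rewrite S0 add0r; apply: (content_null_sub _ aS') => //.
  by apply: set_algebraI => //; exact: AC.
by move=> x [[]].
Qed.

Lemma content_setIC_null S N : A S -> A N -> nu N = 0 -> nu (S `&` ~` N) = nu S.
Proof.
move=> aS aN N0; rewrite [RHS](content_split aS aN).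
have aSN := set_algebraI aS aN.
by rewrite (@content_null_sub (S `&` N) N) ?add0r.
Qed.

(* The sets [F i] may overlap: split [E] along each of them in turn, adding [b]
   to the constant [a] on the part inside [F i]. *)
Lemma simple_ge0_in (I : Type) (r : seq I) (F : I -> set X) (a b : R)
    (E : set X) : (forall i, A (F i)) -> A E ->
  (forall x, E x -> 0 <= a + b * \sum_(i <- r) \1_(F i) x) ->
  0 <= a * nu E + b * \sum_(i <- r) nu (F i `&` E).
Proof.
move=> aF; elim: r a E => [|i r IH] a E aE pos.
  rewrite big_nil mulr0 addr0; have [->|/set0P[x Ex]] := eqVneq E set0.
    by rewrite content_set0 mulr0.
  apply: mulr_ge0; last exact: content_ge0.
  by have := pos _ Ex; rewrite big_nil mulr0 addr0.
have aEF := set_algebraI aE (aF i).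
have aECF := set_algebraI aE (AC (aF i)).
have h1 : 0 <= a * nu (E `&` ~` F i) +
    b * \sum_(j <- r) nu (F j `&` (E `&` ~` F i)).
  apply: IH => // x [Ex nFx]; have := pos _ Ex.
  by rewrite big_cons /= indicE memNset// add0r.
have h2 : 0 <= (a + b) * nu (E `&` F i) +
    b * \sum_(j <- r) nu (F j `&` (E `&` F i)).
  apply: IH => // x [Ex Fx]; have := pos _ Ex.
  by rewrite big_cons /= indicE mem_set// mulrDr mulr1 addrA.
have -> : \sum_(j <- i :: r) nu (F j `&` E) = nu (E `&` F i) +
    (\sum_(j <- r) nu (F j `&` (E `&` F i)) +
     \sum_(j <- r) nu (F j `&` (E `&` ~` F i))).
  rewrite big_cons setIC -big_split; congr (_ + _); apply: eq_bigr => j _.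
  by rewrite !setIA; apply: content_split => //; exact: set_algebraI.
apply: le_trans (addr_ge0 h1 h2) _; rewrite (content_split aE (aF i)).
by rewrite le_eqVlt; apply/orP; left; apply/eqP; ring.
Qed.

(** This is positivity of the integral of a simple function that is nonnegative off a null set. Its
    first term is constant on [G] and on the complement, so [simple_ge0_in] applies to each part. *)
Lemma simple_ge0 (I : finType) (F : I -> set X) (G N : set X) (a b : R) :
  (forall i, A (F i)) -> A G -> A N -> nu N = 0 ->
  (forall x, ~ N x -> 0 <= a * \1_G x + b * \sum_i \1_(F i) x) ->
  0 <= a * nu G + b * \sum_i nu (F i).
Proof.
move=> aF aG aN N0 pos; have aCN := AC aN; have aCG := AC aG.
have h1 : 0 <= a * nu (G `&` ~` N) + b * \sum_i nu (F i `&` (G `&` ~` N)).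
  apply: simple_ge0_in => // [|x [Gx Nx]]; first exact: set_algebraI.
  by have := pos x Nx; rewrite {1}indicE mem_set// mulr1.
have h2 : 0 <= 0 * nu (~` G `&` ~` N) +
    b * \sum_i nu (F i `&` (~` G `&` ~` N)).
  apply: simple_ge0_in => // [|x [Gx Nx]]; first exact: set_algebraI.
  by have := pos x Nx; rewrite {1}indicE memNset// mulr0.
apply: le_trans (addr_ge0 h1 h2) _.
rewrite content_setIC_null// mul0r add0r -addrA -mulrDr -big_split/=.
rewrite le_eqVlt; apply/orP; left; apply/eqP; congr (_ + _ * _).
apply: eq_bigr => i _; have aFG := set_algebraI (aF i) aG.
have aFCG := set_algebraI (aF i) aCG.
rewrite !setIA (content_setIC_null aFG aN N0) (content_setIC_null aFCG aN N0).
by rewrite -content_split.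
Qed.

End Content.

Section SumIndicators.
Context {T : Type} {I : finType} {R : realType}.
Implicit Types (F : I -> set T) (x : T).
Local Open Scope ring_scope.

Lemma sum_indic_le1 F x : (forall i j, F i x -> F j x -> i = j) ->
  \sum_i \1_(F i) x <= 1 :> R.
Proof.
move=> Fx; have [[i Fi]|nF] := pselect (exists i, F i x).
  rewrite (bigD1 i)//= indicE mem_set//= big1 ?addr0// => j ji.
  by rewrite indicE memNset//= => /(Fx _ _ Fi)/eqP; rewrite eq_sym (negbTE ji).
by rewrite big1// => i _; rewrite indicE memNset// => Fi; apply: nF; exists i.
Qed.

Lemma sum_indic_ge1 F x i : F i x -> 1 <= \sum_i \1_(F i) x :> R.
Proof.
move=> Fi; rewrite (bigD1 i)//= indicE mem_set// lerDl.
by apply: sumr_ge0 => j _; rewrite indicE.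
Qed.

Lemma sum_indic_ge2 F x i j : i != j -> F i x -> F j x ->
  2 <= \sum_i \1_(F i) x :> R.
Proof.
move=> ij Fi Fj; rewrite (bigD1 i)//= (bigD1 j)/= 1?eq_sym//.
rewrite !indicE !mem_set//= addrA -[2]/(1 + 1) lerDl.
by apply: sumr_ge0 => k _; rewrite indicE.
Qed.

End SumIndicators.

(** * Arrows indexed by letters *)

Lemma descendant_invK i x : descendant (inv_letter i) (descendant i x) = x.
Proof. by rewrite !descendantE F2_actM letter_elt_inv mulVg F2_act1. Qed.

Lemma descendantK i x : descendant i (descendant (inv_letter i) x) = x.
Proof. by rewrite -{2}(descendant_invK (inv_letter i) x) inv_letterK. Qed.

Lemma coordinate_descendant i x :
  coordinate (descendant i x) 1%g = coordinate x (letter_elt i).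
Proof. by rewrite descendantE /F2_act {1}/coordinate mul1g. Qed.

Definition arrow_along (c : shift_space -> colour) (i : letter) :
    set shift_space :=
  [set x | (coordinate x 1%g, coloured_P (c x)) = i].

(** At a free point distinct letters lead to distinct neighbours, and only the inverse letter leads
    back, so arrows into [x] can be counted by letters. *)
Lemma two_arrowsP c x : free_point x ->
  two_arrows_to x (fun i => c (descendant i x)) <->
  exists i j, [/\ i != j,
    arrow_along c (inv_letter i) (descendant i x) &
    arrow_along c (inv_letter j) (descendant j x)].
Proof.
move=> fx.
have arrowP i : arrow_target (descendant i x) (c (descendant i x)) = x <->
    arrow_along c (inv_letter i) (descendant i x).
  rewrite /arrow_target /arrow_along /=; set l := (_, _); split=> [lx|->].
    apply: letter_elt_inj; rewrite letter_elt_inv.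
    apply/esym/(free_act_inj (free_descendant (i := i) fx)).
    rewrite -letter_elt_inv -descendantE descendant_invK -{1}lx.
    by rewrite descendantE.
  exact: descendant_invK.
split=> [[i [j [ij ix jx]]]|[i [j [ij ix jx]]]]; exists i, j.
  by split; [apply: contra_notN ij => /eqP ->|exact/arrowP|exact/arrowP].
split; [|exact/arrowP|exact/arrowP].
rewrite !descendantE => /(free_act_inj fx)/letter_elt_inj/eqP.
by rewrite (negbTE ij).
Qed.

(** * Contradiction from an invariant extension *)

Section Paradox.
Context {R : realType} (m : probability shift_space R).
Hypothesis hm : is_fair_product_measure m.
Variables (A : set (set shift_space)) (mu : set shift_space -> \bar R).
Hypotheses (Amu : finitely_additive_probability A mu) (extm : extends m A mu).
Hypothesis mupres : preserved_by_descendants descendant A mu.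
Variable c : shift_space -> colour.
Hypothesis csat : satisfies m descendant allowed_colour c.
Hypothesis Ac : forall col, A (c @^-1` [set col]).
Local Open Scope ring_scope.

Let nu S : R := fine (mu S).

Let AC S : A S -> A (~` S).
Proof. by case: Amu => -[_ h _] _ _ _; exact: h. Qed.

Let AU S S' : A S -> A S' -> A (S `|` S').
Proof. by case: Amu => -[_ _ h] _ _ _; exact: h. Qed.

Let AI S S' : A S -> A S' -> A (S `&` S').
Proof. exact: set_algebraI Amu _ _. Qed.

Let Ameas S : measurable S -> A S. Proof. by case/extm. Qed.

Let Apre i S : A S -> A (descendant i @^-1` S). Proof. by case/(mupres i). Qed.

Let nu_pre i S : A S -> nu (descendant i @^-1` S) = nu S.
Proof. by case/(mupres i) => _ h; rewrite /nu h. Qed.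

Let nu_cylinder l : uniq (unzip1 l) -> nu (cylinder l) = 2^-1 ^+ size l.
Proof.
move=> ul; have [_ h] := extm (measurable_cylinder l).
by rewrite /nu h (cylinder_fair hm).
Qed.

(** Negligible sets lie in measurable null sets, where [mu] agrees with [m]; a single [N] absorbs
    the non-free points and the failures of the rule. *)
Let exceptional_set : exists N, [/\ A N, nu N = 0 &
  forall x, ~ N x -> free_point x /\
  allowed_colour x (fun i => c (descendant i x)) (c x)].
Proof.
have [N [mN N0 sub]] := negligibleU (negligible_not_free hm) csat.
exists N; have [AN muN] := extm mN; split=> [//||x nN].
  by rewrite /nu muN N0.
by split; apply: contrapT => nx; apply: nN; apply: sub; [left|right].
Qed.

Let C : set shift_space := [set x | crowded (c x)].

Let AP : A [set x | coloured_P (c x)].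
Proof.
rewrite (_ : [set _ | _] = c @^-1` [set Pu] `|` c @^-1` [set Pc]).
  by apply: AU; exact: Ac.
apply/seteqP; split=> x /=; last by case=> ->.
by case: (c x) => // _; [left|right].
Qed.

Let ACr : A C.
Proof.
rewrite (_ : C = c @^-1` [set Pc] `|` c @^-1` [set Nc]).
  by apply: AU; exact: Ac.
apply/seteqP; split=> x; rewrite /C /=; last by case=> ->.
by case: (c x) => // _; [left|right].
Qed.

Let Acoord g b : A [set x | coordinate x g = b].
Proof. by apply: Ameas; exact: measurable_coordinate. Qed.

Let AS i : A (arrow_along c i).
Proof.
rewrite (_ : arrow_along c i = [set x | coordinate x 1%g = i.1] `&`
    if i.2 then [set x | coloured_P (c x)] else ~` [set x | coloured_P (c x)]).
  by apply: AI => //; case: i.2 => //; exact: AC.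
case: i => a s; apply/seteqP; split=> x; rewrite /arrow_along /=.
  by move=> [-> <-]; split=> //; case: ifP => //= ->.
by case=> -> /=; case: s => /= [->|/negP/negbTE ->].
Qed.

(** Membership of [x] means that its neighbour in direction [i] sends its arrow to [x]. *)
Let B i : set shift_space := descendant i @^-1` arrow_along c (inv_letter i).

Let AB i : A (B i). Proof. exact: Apre. Qed.

(* Every point is an edge between its two possible targets; [G a] is the set of
   edges of label [a] whose two ends are crowded, and [D i] the set of crowded
   points joined to a crowded point by the edge in direction [i]. *)
Let G a : set shift_space := [set x | coordinate x 1%g = a] `&`
  (descendant (a, true) @^-1` C `&` descendant (a, false) @^-1` C).

Let AG a : A (G a). Proof. by apply: AI => //; apply: AI; exact: Apre. Qed.

Let D i : set shift_space := descendant i @^-1` G i.1.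

Let DC i : D i `<=` C.
Proof.
move=> x [_ []]; case: i => a [] /=.
  by move=> _; rewrite (descendant_invK (a, true)).
by rewrite (descendant_invK (a, false)).
Qed.

Let E i := arrow_along c i `&` descendant i @^-1` C.

Let AE i : A (E i). Proof. by apply: AI => //; exact: Apre. Qed.

(** Both sides count the arrows along [i] into crowded points, on the left at their sources and on
    the right at their targets. *)
Let nuE i : nu (E i) = nu (B (inv_letter i) `&` C).
Proof.
rewrite -(nu_pre (inv_letter i) (AE i)); congr nu.
by apply/seteqP; split=> x; rewrite /B /E /= inv_letterK descendantK.
Qed.

Let crowded_in_arrows : 2 * nu C <= \sum_i nu (B i `&` C).
Proof.
have [N [aN nN rule]] := exceptional_set.
rewrite -subr_ge0 addrC -mulNr -[X in _ + X]mul1r.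
apply: (simple_ge0 Amu _ _ aN) => // [i|x /rule[fx [_ _ xC]]].
  exact: AI.
have [Cx|nCx] := pselect (C x); last first.
  rewrite {1}indicE memNset// mulr0 add0r mul1r.
  by apply: sumr_ge0 => i _; rewrite indicE.
rewrite {1}indicE mem_set// mulr1 mul1r addrC subr_ge0.
have /xC/(two_arrowsP _ fx)[i [j [ij xi xj]]] := Cx.
exact: (sum_indic_ge2 ij).
Qed.

(** Were the other end of an edge pointing to a crowded point uncrowded, the rule would force the
    opposite arrow. Each edge carries only one arrow. *)
Let out_arrows_crowded a : \sum_s nu (E (a, s)) <= nu (G a).
Proof.
have [N [aN nN rule]] := exceptional_set.
rewrite -subr_ge0 -mulN1r -[X in X + _]mul1r.
apply: (simple_ge0 Amu _ _ aN) => // x /rule[fx [xP xN _]].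
rewrite mul1r mulN1r subr_ge0.
have EG s : E (a, s) x -> G a x.
  rewrite /E /G /arrow_along /= => -[[xa xs] xC]; split=> //.
  rewrite !xa in xP xN; move: xC xP xN; rewrite -xs /C /=.
  case: (coloured_P (c x)) => Cx.
  - rewrite Cx; case: (crowded _) => // _ /(_ isT isT) //.
  - rewrite Cx; case: (crowded _) => // /(_ isT isT) //.
have [Gx|nGx] := pselect (G a x).
  rewrite [leRHS]indicE mem_set//; apply: sum_indic_le1 => s t [] + _ [] + _.
  by rewrite /arrow_along /= => -[_ <-] [].
rewrite [leRHS]indicE memNset// big1// => s _.
by rewrite indicE memNset// => /EG.
Qed.

(** A translate of each [G a] lies in [C], while counting arrows at both ends bounds the sum over
    the two labels below by [2 * nu C]. *)
Let nuG a : nu (G a) = nu C.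
Proof.
have nuGC b : nu (G b) <= nu C.
  rewrite -(nu_pre (b, true) (AG b)); apply: (content_le Amu) => //.
    exact: Apre.
  exact: (@DC (b, true)).
have : 2 * nu C <= nu (G true) + nu (G false).
  apply: le_trans crowded_in_arrows _.
  apply: le_trans (lerD (out_arrows_crowded true) (out_arrows_crowded false)).
  rewrite (reindex_inj (inv_inj inv_letterK))/=.
  rewrite -(big_bool _ (fun a => \sum_s nu (E (a, s)))) pair_bigA le_eqVlt.
  by apply/orP; left; apply/eqP/eq_bigr => -[a' s] _; exact/esym/nuE.
have := nuGC true; have := nuGC false; case: a; lra.
Qed.

Let a1 : letter := (true, true).

(** An edge labelled [a] lies halfway between its ends, which are [T_a^2] apart; hence the odd
    exponents. *)
Let K n := cylinder [seq ((gen true ^+ k.*2.+1)%g, true) | k <- iota 0 n].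

Let nuK n : nu (K n) = 2^-1 ^+ n.
Proof.
rewrite nu_cylinder ?size_map ?size_iota// /unzip1 -map_comp.
rewrite map_inj_uniq ?iota_uniq//.
move=> k l /= /(congr1 (size \o word_of)) /=.
by rewrite !word_expg_gen !size_nseq => -[] /double_inj.
Qed.

(** For almost every crowded [x], the label of [T_a x] is [a] and [T_a^2 x] is crowded; the
    induction hypothesis pulled back along [T_a^2] gives the remaining labels. *)
Let CK n : nu (C `&` ~` K n) = 0.
Proof.
have aK k : A (K k) by apply: Ameas; exact: measurable_cylinder.
have aD : A (D a1) by exact: Apre.
elim: n => [|n IH].
  rewrite (_ : K 0 = setT); last by apply/seteqP; split.
  by rewrite setCT setI0; exact: content_set0 Amu.
have CD0 : nu (C `&` ~` D a1) = 0.
  have := content_split Amu ACr aD; rewrite setIidr; last exact: DC.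
  by rewrite -!/(nu _) (nu_pre _ (AG _)) nuG; lra.
pose T := descendant a1.
have aCK : A (C `&` ~` K n) by apply: AI => //; exact: AC.
have aTCK : A (T @^-1` (T @^-1` (C `&` ~` K n))) by do 2 apply: Apre.
have TCK0 : nu (T @^-1` (T @^-1` (C `&` ~` K n))) = 0.
  by rewrite !nu_pre//; exact: Apre.
have aCD : A (C `&` ~` D a1) by apply: AI => //; exact: AC.
apply: (content_null_sub Amu _ _ _ (content_setU_null Amu aCD aTCK CD0 TCK0)).
- by apply: AI => //; exact: AC.
- exact: AU.
move=> x [Cx nKx]; have [[xa [CTT _]]|nDx] := pselect (D a1 x); last by left.
right; split=> // Kx; apply: nKx => _ /mapP[k + ->] /=.
rewrite mem_iota add0n; case: k => [_|k kn].
  by rewrite -[RHS]xa coordinate_descendant expg1.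
have kK : ((gen true ^+ k.*2.+1)%g, true) \in
    [seq ((gen true ^+ k.*2.+1)%g, true) | k <- iota 0 n].
  by apply/mapP; exists k => //; rewrite mem_iota.
rewrite -[RHS](Kx _ kK) /T !descendantE F2_actM /F2_act [RHS]/coordinate /=.
by rewrite (_ : letter_elt a1 = gen true)// mulgA doubleS -!expgSr.
Qed.

Let nuC : nu C = 0.
Proof.
apply/eqP; rewrite eq_le (content_ge0 Amu)// andbT; apply: pow2_le0 => n.
have aK : A (K n) by apply: Ameas; exact: measurable_cylinder.
have := content_split Amu ACr aK; rewrite -!/(nu _) CK addr0 => ->.
by rewrite -nuK; apply: (content_le Amu) => //; exact: AI.
Qed.

(** On [Z] each neighbour is labelled by the other generator, so [x] lies in no [B i], whatever the
    colouring. *)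
Let Z := cylinder [seq (letter_elt i, ~~ i.1) | i <- enum {: letter}].

Let nuZ : 0 < nu Z.
Proof.
rewrite nu_cylinder ?exprn_gt0 ?invr_gt0//.
by rewrite /unzip1 -map_comp map_inj_uniq ?enum_uniq//; exact: letter_elt_inj.
Qed.

(** Every point emits an arrow along some letter, without exception: the null set is empty here. *)
Let sum_out : 1 <= \sum_i nu (arrow_along c i).
Proof.
have aT : A setT by case: Amu => -[].
have a0 : A set0 by rewrite -setCT; exact: AC.
rewrite -subr_ge0 addrC -(content_setT Amu) -mulN1r -[X in _ + X]mul1r.
apply: (simple_ge0 Amu _ aT a0 (content_set0 Amu)) => // x _.
rewrite mulN1r mul1r addrC subr_ge0 [leLHS]indicE in_setT.
by apply: (@sum_indic_ge1 _ _ _ _ _ (coordinate x 1%g, coloured_P (c x))).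
Qed.

Lemma no_invariant_extension : False.
Proof.
have [N [aN nN rule]] := exceptional_set.
have aT : A setT by case: Amu => -[].
have aZ : A Z by apply: Ameas; exact: measurable_cylinder.
have aNC : A (N `|` C) by exact: AU.
have nNC := content_setU_null Amu aN ACr nN nuC.
(* Off [N] and [C] a point receives at most one arrow, and none on [Z]. *)
have : 0 <= 1 * nu (~` Z) + - 1 * \sum_i nu (B i).
  apply: (simple_ge0 Amu AB (AC aZ) aNC nNC) => x.
  move=> /not_orP[/rule[fx [_ _ xC]] nCx].
  rewrite mul1r mulN1r subr_ge0.
  have [Zx|nZx] := pselect (Z x).
    rewrite [leRHS]indicE memNset; last by move=> /(_ Zx).
    rewrite big1// => i _; rewrite indicE memNset//.
    rewrite /B /arrow_along /= => -[xi _].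
    have /Zx /= : (letter_elt i, ~~ i.1) \in
        [seq (letter_elt i, ~~ i.1) | i <- enum {: letter}].
      by apply/mapP; exists i; rewrite ?mem_enum.
    by rewrite -coordinate_descendant xi; case: i.1.
  rewrite [leRHS]indicE mem_set//; apply: sum_indic_le1 => i j xi xj.
  apply/eqP/negPn/negP => ij; apply: nCx; apply/xC/two_arrowsP => //.
  by exists i, j.
have := content_split Amu aT aZ; rewrite -!/(nu _) !setTI.
have := content_setT Amu; rewrite -/(nu _) => ->.
(* By invariance, incoming and outgoing arrows have the same total, so [1 <= 1 - nu Z], against
   [nuZ]. *)
under eq_bigr do rewrite nu_pre//.
have := sum_out; rewrite (reindex_inj (inv_inj inv_letterK))/=.
move: nuZ; lra.
Qed.

End Paradox.

Theorem theorem3 (R : realType) (m : probability shift_space R)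
  (hm : is_fair_product_measure m) :
  is_colouring_rule m descendant allowed_colour /\
  paradoxical m descendant allowed_colour.
Proof.
split; first exact: colouring_rule.
split; first by exists outward_colour; exact: outward_colour_satisfies.
move=> [A [mu [Amu extm mupres [c [csat Ac]]]]].
exact: (no_invariant_extension hm Amu extm mupres csat Ac).
Qed.
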